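(* Let $k$ be an infinite field and let $K\subset L$ be $k$-fields (so $k\subset K\subset L$). If $K$ is retract $k$-rational and $L$ is retract $K$-rational, then $L$ is retract $k$-rational.
   Context: For a field $k$, a $k$-field is a finitely generated field extension of $k$. Affine domain: an affine domain over a field $F$ is an integral domain of the form $F[\alpha_1,\ldots,\alpha_m]$, i.e. finitely generated as an $F$-algebra. Retract rationality: let $F$ be an infinite field and $E$ a field containing $F$. $E$ is called retract $F$-rational if there are an affine domain $A$ over $F$, a polynomial ring $F[X_1,\ldots,X_n]$, a nonzero polynomial $f\in F[X_1,\ldots,X_n]$, and $F$-algebra morphisms $\varphi:A\to F[X_1,\ldots,X_n][1/f]$ and $\psi:F[X_1,\ldots,X_n][1/f]\to A$ such that (i) $E$ is the quotient field of $A$, and (ii) $\psi\circ\varphi=1_A$, the identity map on $A$. *)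

(* Defs.v *)
From HB Require Import structures.
From mathcomp Require Import all_boot all_order all_algebra.
From mathcomp Require Import boolp classical_sets cardinality.
From mathcomp Require Import mpoly.

Set Implicit Arguments.
Unset Strict Implicit.
Unset Printing Implicit Defensive.

Import GRing.Theory.
Local Open Scope ring_scope.

(* A ring extension, or more generally an algebra over a ring R, is given by
   its structure morphism out of R; a field extension is thus a morphism
   i : {rmorphism F -> E} between fields, which is automatically injective. *)

Section Localization.
Variables (R : idomainType) (f : R).

(* R[1/f], realized inside the fraction field of R; only used for f != 0. *)
Definition in_localization : {pred {fraction R}} :=
  fun x => `[< exists (p : R) (m : nat), x = tofrac p / tofrac f ^+ m >].

Lemma in_localizationP x :
  reflect (exists (p : R) (m : nat), x = tofrac p / tofrac f ^+ m)
    (x \in in_localization).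
Proof. exact: asboolP. Qed.

Lemma tofrac_in_localization p : tofrac p \in in_localization.
Proof. by apply/in_localizationP; exists p, 0%N; rewrite expr0 divr1. Qed.

Fact in_localization_subring : subring_closed in_localization.
Proof.
split=> [|x y|x y].
- by rewrite -tofrac1 tofrac_in_localization.
- move=> /in_localizationP[p [m ->]] /in_localizationP[q [l ->]].
  have [f0|f0] := eqVneq (tofrac f) 0.
    have E0 (r : R) (j : nat) : exists s, tofrac r / tofrac f ^+ j = tofrac s.
      case: j => [|j]; first by exists r; rewrite expr0 divr1.
      by exists 0; rewrite f0 expr0n /= invr0 mulr0 tofrac0.
    have [[s ->] [t ->]] := (E0 p m, E0 q l).
    by rewrite -tofracB tofrac_in_localization.
  apply/in_localizationP; exists (p * f ^+ l - q * f ^+ m), (m + l)%N.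
  have fX j : tofrac f ^+ j != 0 by rewrite expf_neq0.
  rewrite tofracB !tofracM !tofracXn exprD mulrBl; congr (_ - _).
    by rewrite -mulf_div divff // mulr1.
  by rewrite [tofrac f ^+ m * _]mulrC -mulf_div divff // mulr1.
move=> /in_localizationP[p [m ->]] /in_localizationP[q [l ->]].
apply/in_localizationP; exists (p * q), (m + l)%N.
by rewrite tofracM exprD invfM mulrACA.
Qed.

HB.instance Definition _ :=
  GRing.isSubringClosed.Build {fraction R} in_localization
    in_localization_subring.

Record localization := Localization {
  localization_val :> {fraction R};
  _ : localization_val \in in_localization }.

HB.instance Definition _ := [isSub for localization_val].
HB.instance Definition _ := [Choice of localization by <:].
HB.instance Definition _ := [SubChoice_isSubComNzRing of localization by <:].

Definition to_localization (p : R) : localization :=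
  Localization (tofrac_in_localization p).

Fact to_localization_zmod_morphism : zmod_morphism to_localization.
Proof. by move=> p q; apply: val_inj; rewrite /= tofracB. Qed.

Fact to_localization_monoid_morphism : monoid_morphism to_localization.
Proof. by split=> [|p q]; apply: val_inj; rewrite /= ?tofrac1 ?tofracM. Qed.

HB.instance Definition _ := GRing.isZmodMorphism.Build R localization
  to_localization to_localization_zmod_morphism.
HB.instance Definition _ := GRing.isMonoidMorphism.Build R localization
  to_localization to_localization_monoid_morphism.

End Localization.

(* E = F(s_0, ..., s_(m-1)) for some m and some s_j in E. *)
Definition fg_field_ext (F E : fieldType) (i : {rmorphism F -> E}) : Prop :=
  exists (m : nat) (s : 'I_m -> E), forall x : E,
    exists p q : {mpoly F[m]}, mmap i s q != 0 /\ x = mmap i s p / mmap i s q.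

(* A = F[s_0, ..., s_(m-1)] for some m and some s_j in A. *)
Definition fg_algebra (F : fieldType) (A : idomainType)
    (a : {rmorphism F -> A}) : Prop :=
  exists (m : nat) (s : 'I_m -> A), forall x : A,
    exists p : {mpoly F[m]}, x = mmap a s p.

Definition is_quotient_field (A : idomainType) (E : fieldType)
    (e : {rmorphism A -> E}) : Prop :=
  injective e /\ forall x : E, exists u v : A, v != 0 /\ x = e u / e v.

Definition retract_rational (F E : fieldType) (i : {rmorphism F -> E}) : Prop :=
  exists (A : idomainType) (a : {rmorphism F -> A}) (e : {rmorphism A -> E})
         (n : nat) (f : {mpoly F[n]})
         (phi : {rmorphism A -> localization f})
         (psi : {rmorphism localization f -> A}),
    [/\ fg_algebra a,
        is_quotient_field e /\ (forall c : F, e (a c) = i c),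
        f != 0,
        (forall c : F, phi (a c) = to_localization f c%:MP) /\
        (forall c : F, psi (to_localization f c%:MP) = a c)
      & forall x : A, psi (phi x) = x].

(* Main.v *)
(* E is retract F-rational iff there are a point of an affine space A^n over F
   with residue field E and an F-algebra section sigma of the residue map of its
   local ring.  Sections compose: from sigma : K -> k(X) at x and
   rho : L -> K(Y) at y, extend sigma to the part of K(Y) regular at y, and get
   a section L -> k(X, Y) at the point (x, y).  Every element produced is regular
   at (x, y), with the expected value, so no denominator vanishes. *)
Require Import Defs.
From HB Require Import structures.
From mathcomp Require Import all_boot all_order all_algebra.
From mathcomp Require Import boolp classical_sets cardinality.
From mathcomp Require Import mpoly ring.

Set Implicit Arguments.
Unset Strict Implicit.
Unset Printing Implicit Defensive.

Import GRing.Theory.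
Local Open Scope ring_scope.

(** * Subrings of a field as integral domains *)

Section SubringOfField.
Variables (E : fieldType) (S : subringClosed E).

Record subring_of := SubringOf {
  subring_of_val :> E;
  _ : subring_of_val \in S }.

HB.instance Definition _ := [isSub for subring_of_val].
HB.instance Definition _ := [Choice of subring_of by <:].
HB.instance Definition _ := [SubChoice_isSubComNzRing of subring_of by <:].

Let unit : {pred subring_of} := [pred x | (val x != 0) && ((val x)^-1 \in S)].
(** The default [x] makes inversion the identity on non-units, as [inv_out] demands; zero fits too,
    since its inverse in [E] is 0. *)
Let inv (x : subring_of) : subring_of := insubd x (val x)^-1.

Let mulVx : {in unit, left_inverse 1 inv *%R}.
Proof.
move=> x /andP[x0 xS]; apply: val_inj.
by rewrite rmorphM rmorph1 /= /inv /insubd insubT mulVf.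
Qed.

Let unitPl x y : y * x = 1 -> unit x.
Proof.
move=> /(congr1 val); rewrite rmorphM rmorph1 /= => yx.
have x0 : val x != 0.
  by apply: contra_eq_neq yx => ->; rewrite mulr0 eq_sym oner_neq0.
have -> : (unit x : bool) = (val x != 0) && ((val x)^-1 \in S) by [].
by rewrite x0 -[_^-1]mul1r -yx mulfK ?(valP y).
Qed.

Let inv_out : {in [predC unit], inv =1 id}.
Proof.
move=> x; rewrite inE /= => xN; rewrite /inv /insubd.
have [x0|x0] := eqVneq (val x) 0.
  rewrite x0 invr0; case: insubP => [y _ y0|//].
  by apply: val_inj; rewrite y0 x0.
case: insubP => // y yS _; case/negP: xN.
by apply/andP; split.
Qed.

HB.instance Definition _ :=
  GRing.ComNzRing_hasMulInverse.Build subring_of mulVx unitPl inv_out.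
HB.instance Definition _ :=
  [SubComUnitRing_isSubIntegralDomain of subring_of by <:].
End SubringOfField.


(** * Morphisms prescribed on fractions *)

Section GraphMorphism.
Variables (R : comNzRingType) (D T : nzRingType) (S1 S2 : fieldType).
Variables (d : {rmorphism D -> S1}) (t : {rmorphism T -> S2}).
Variables (h1 : {rmorphism R -> S1}) (h2 : {rmorphism R -> S2}).

(* The morphism sends h1 a / h1 b to h2 a / h2 b; [d] and [t] only allow its
   domain and codomain to be subrings of the two fields. *)
Lemma fraction_rmorphism :
    injective t -> (forall r, h1 r = 0 -> h2 r = 0) ->
    (forall y, exists a b z,
      [/\ h2 b != 0, d y = h1 a / h1 b & t z = h2 a / h2 b]) ->
  exists phi : {rmorphism D -> T}, forall y a b,
    h2 b != 0 -> d y = h1 a / h1 b -> t (phi y) = h2 a / h2 b.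
Proof.
move=> t_inj ker12 dT.
have h1N b : h2 b != 0 -> h1 b != 0.
  by apply: contra_neq => /ker12.
(* Well-definedness: equal fractions on the [h1] side put [a * b' - a' * b] in the kernel of [h1],
   hence in that of [h2]. *)
have fracE a b a' b' : h2 b != 0 -> h2 b' != 0 ->
    h1 a / h1 b = h1 a' / h1 b' -> h2 a / h2 b = h2 a' / h2 b'.
  move=> b0 b'0 /eqP; rewrite eqr_div ?h1N // -!rmorphM -subr_eq0 -rmorphB.
  move=> /eqP/ker12/eqP; rewrite rmorphB subr_eq0 !rmorphM -eqr_div //.
  by move/eqP.
have {dT} dT y : exists z, exists a b,
    [/\ h2 b != 0, d y = h1 a / h1 b & t z = h2 a / h2 b].
  by have [a [b [z ?]]] := dT y; exists z, a, b.
have [phi phiP] := choice dT.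
have phiE y a b : h2 b != 0 -> d y = h1 a / h1 b -> t (phi y) = h2 a / h2 b.
  have [a' [b' [b'0 dy ->]]] := phiP y; move=> b0 dy'.
  by apply: fracE => //; rewrite -dy.
have phiB : zmod_morphism phi.
  move=> y y'; apply: t_inj; rewrite rmorphB.
  have [a [b [b0 dy ->]]] := phiP y; have [a' [b' [b'0 dy' ->]]] := phiP y'.
  rewrite (phiE _ (a * b' - a' * b) (b * b')) ?rmorphM ?mulf_neq0 //.
    by rewrite rmorphB !rmorphM; field; rewrite b0 b'0.
  by rewrite !rmorphB dy dy' !rmorphM; field; rewrite !h1N.
have phiM : monoid_morphism phi.
  split=> [|y y']; apply: t_inj.
    by rewrite (phiE _ 1 1) ?rmorph1 ?oner_neq0 ?divr1.
  rewrite rmorphM.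
  have [a [b [b0 dy ->]]] := phiP y; have [a' [b' [b'0 dy' ->]]] := phiP y'.
  rewrite (phiE _ (a * a') (b * b')) ?rmorphM ?mulf_neq0 //.
    by rewrite mulf_div.
  by rewrite dy dy' mulf_div.
pose phim : {rmorphism D -> T} := HB.pack phi
  (GRing.isZmodMorphism.Build D T phi phiB)
  (GRing.isMonoidMorphism.Build D T phi phiM).
by exists phim.
Qed.

End GraphMorphism.

(** * The local ring at a point and its residue map *)

Section RegularAt.
Variables (R : idomainType) (E : fieldType) (ev : {rmorphism R -> E}).

(** The graph of the residue map of the local ring at the kernel of [ev]. As a relation it avoids
    building that local ring. *)
Definition regular_at (t : {fraction R}) (l : E) : Prop :=
  exists a b, [/\ ev b != 0, t = tofrac a / tofrac b & l = ev a / ev b].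

Lemma tofrac_neq0 b : ev b != 0 -> tofrac b != 0.
Proof.
by apply: contra_neq => /eqP; rewrite tofrac_eq0 => /eqP->; rewrite rmorph0.
Qed.

Lemma regular_at_tofrac a : regular_at (tofrac a) (ev a).
Proof. by exists a, 1; rewrite !rmorph1 !divr1 oner_neq0. Qed.

Lemma regular_atD t l t' l' :
  regular_at t l -> regular_at t' l' -> regular_at (t + t') (l + l').
Proof.
move=> [a [b [b0 -> ->]]] [a' [b' [b'0 -> ->]]].
exists (a * b' + a' * b), (b * b').
by rewrite !rmorphD !rmorphM /= mulf_neq0 // !addf_div ?tofrac_neq0.
Qed.

Lemma regular_atM t l t' l' :
  regular_at t l -> regular_at t' l' -> regular_at (t * t') (l * l').
Proof.
move=> [a [b [b0 -> ->]]] [a' [b' [b'0 -> ->]]]; exists (a * a'), (b * b').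
by rewrite !rmorphM mulf_neq0 // !mulf_div.
Qed.

Lemma regular_atV t l : l != 0 -> regular_at t l -> regular_at t^-1 l^-1.
Proof.
move=> l0 [a [b [b0 -> lE]]]; exists b, a; rewrite lE !invf_div; split=> //.
by apply: contra_neq l0; rewrite lE => ->; rewrite mul0r.
Qed.

Lemma regular_at_neq0 t l : l != 0 -> regular_at t l -> t != 0.
Proof.
move=> l0 [a [b [b0 -> lE]]]; rewrite mulf_neq0 ?invr_neq0 ?tofrac_neq0 //.
by apply: contra_neq l0; rewrite lE => ->; rewrite mul0r.
Qed.

(** Cross-multiplying in [R] shows that a residue does not depend on the fraction chosen. *)
Lemma regular_atE t l a b :
  regular_at t l -> ev b != 0 -> t = tofrac a / tofrac b -> l = ev a / ev b.
Proof.
move=> [a' [b' [b'0 -> ->]]] b0 /eqP.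
rewrite eqr_div ?tofrac_neq0 // -!tofracM tofrac_eq => /eqP abE.
by apply/eqP; rewrite eqr_div // -!rmorphM abE.
Qed.

End RegularAt.

Lemma mpoly_generated_ind (F : comNzRingType) (n : nat)
    (P : {mpoly F[n]} -> Prop) :
    (forall c, P c%:MP) -> (forall a, P 'X_a) ->
    (forall p q, P p -> P q -> P (p + q)) ->
    (forall p q, P p -> P q -> P (p * q)) ->
  forall p, P p.
Proof.
move=> PC PX PD PM p; rewrite [p]mpolyE.
apply: big_ind => [|//|m _]; first by rewrite -mpolyC0.
rewrite -mul_mpolyC mpolyXE_id; apply: (PM) => //.
apply: big_ind => [|//|a _]; first by rewrite -mpolyC1.
by elim: (m a) => [|e IH]; rewrite ?expr0 ?exprS -?mpolyC1 //; exact: PM.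
Qed.

(** * From retractions to sections of residue maps *)

(* The morphism [ev] is a point of affine n-space; its local ring has residue
   field [E] and [sigma] splits the residue map as an [F]-algebra morphism. *)
Definition residue_split (F E : fieldType) (i : {rmorphism F -> E}) : Prop :=
  exists (n : nat) (ev : {rmorphism {mpoly F[n]} -> E})
         (sigma : {rmorphism E -> {fraction {mpoly F[n]}}}),
    [/\ forall c, ev c%:MP = i c, forall c, sigma (i c) = tofrac c%:MP
      & forall l, regular_at ev (sigma l) l].

(** The point is the restriction of [e \o psi] to polynomials. Having the left inverse [psi], [phi]
    is injective and extends to the quotient field [E] of [A]; the residue of [phi u] is
    [e (psi (phi u)) = e u]. *)
Lemma retract_rational_residue_split (F E : fieldType)
    (i : {rmorphism F -> E}) :
  retract_rational i -> residue_split i.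
Proof.
move=> [A [a [e [n [f [phi [psi [_ [[e_inj eP] eaE] f0 [phiC psiC] psiK]]]]]]]].
pose ev : {rmorphism {mpoly F[n]} -> E} := e \o psi \o @to_localization _ f.
pose h2 : {rmorphism A -> {fraction {mpoly F[n]}}} := val \o phi.
have h2_inj : injective h2.
  by apply: inj_comp; [exact: val_inj | exact: can_inj psiK].
have tf0 : tofrac f != 0 by rewrite tofrac_eq0.
have fX_inv m : exists z : localization f, val z * tofrac f ^+ m = 1.
  have zP : tofrac 1 / tofrac f ^+ m \in in_localization f.
    by apply/in_localizationP; exists 1, m.
  by exists (Localization zP); rewrite /= tofrac1 div1r mulVf ?expf_neq0.
(* The point lies off the hypersurface f = 0, because f is a unit of the localization. *)
have ev_f m : ev (f ^+ m) != 0.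
  have [z zf] := fX_inv m.
  have /(congr1 (e \o psi)) : z * to_localization f (f ^+ m) = 1.
    by apply: val_inj; rewrite rmorphM rmorph1 /= tofracXn.
  rewrite /= !rmorphM !rmorph1 => zf1.
  apply: contra_eq_neq zf1 => evf0.
  by rewrite [e (psi (to_localization _ _))]evf0 mulr0 eq_sym oner_neq0.
have h2_reg u : regular_at ev (h2 u) (e u).
  have /in_localizationP[p [m phiu]] := valP (phi u).
  exists p, (f ^+ m); split=> //; first by rewrite tofracXn.
  apply/eqP; rewrite -(inj_eq (mulIf (ev_f m))) divfK //; apply/eqP.
  rewrite -{1}(psiK u) /ev /= -!rmorphM; congr (e (psi _)); apply: val_inj.
  by rewrite rmorphM /= phiu tofracXn divfK ?expf_neq0.
have [||u|sigma sigmaP] := @fraction_rmorphism A E _ E _ idfun idfun e h2.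
- by [].
- by move=> r /eqP; rewrite raddf_eq0 // => /eqP->; rewrite rmorph0.
- have [x [y [y0 ->]]] := eP u; exists x, y, (h2 x / h2 y).
  by rewrite raddf_eq0.
exists n, ev, sigma; split=> [c|c|l].
- by rewrite /ev /= psiC eaE.
- rewrite -eaE [LHS](sigmaP _ (a c) 1) ?rmorph1 ?oner_neq0 ?divr1 //.
  by rewrite /h2 /= phiC.
have [x [y [y0 lE]]] := eP l.
rewrite [sigma l](sigmaP _ x y) ?raddf_eq0 // lE.
by apply/regular_atM => //; apply: regular_atV; rewrite ?raddf_eq0.
Qed.

(** * Composition of sections *)

Lemma residue_split_lift (R R' : idomainType) (E E' : fieldType)
    (ev : {rmorphism R -> E}) (ev' : {rmorphism R' -> E'})
    (g : {rmorphism E -> E'}) (h : {rmorphism R -> {fraction R'}})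
    (sigma : {rmorphism E -> {fraction R}}) :
    (forall r, regular_at ev' (h r) (g (ev r))) ->
    (forall l, regular_at ev (sigma l) l) ->
  exists theta : {rmorphism E -> {fraction R'}},
    (forall l, regular_at ev' (theta l) (g l)) /\
    (forall l a, sigma l = tofrac a -> theta l = h a).
Proof.
move=> h_reg sigma_reg.
(* [h] is not assumed injective: a denominator that is nonzero at the point keeps a nonzero residue
   in [E'], so its image is nonzero. *)
have h_neq0 b : ev b != 0 -> h b != 0.
  by move=> b0; apply: regular_at_neq0 (h_reg b); rewrite fmorph_eq0.
have [||l|theta thetaP] :=
    @fraction_rmorphism R E _ _ _ sigma idfun (@tofrac R) h.
- by [].
- by move=> r /eqP; rewrite tofrac_eq0 => /eqP->; rewrite rmorph0.
- have [a [b [b0 -> _]]] := sigma_reg l; exists a, b, (h a / h b).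
  by rewrite h_neq0.
exists theta; split=> [l|l a lE].
  have [a [b [b0 sl lE]]] := sigma_reg l.
  rewrite [theta l](thetaP _ a b) ?h_neq0 // lE fmorph_div.
  by apply: regular_atM => //; apply: regular_atV; rewrite ?fmorph_eq0.
by rewrite [LHS](thetaP _ a 1) ?rmorph1 ?oner_neq0 ?divr1.
Qed.

Lemma residue_split_trans (k K L : fieldType)
    (i : {rmorphism k -> K}) (j : {rmorphism K -> L}) :
  residue_split i -> residue_split j -> residue_split (j \o i).
Proof.
move=> [n [ev [sigma [evC sigmaC sigma_reg]]]].
move=> [m [ev2 [rho [ev2C rhoC rho_reg]]]].
(* The point (x, y): the coordinates of x are carried into [L] by [j], those of y already lie
   there. *)
pose ev' : {rmorphism {mpoly k[n + m]} -> L} := mmap (j \o i) (fun s =>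
  match split s with inl a => j (ev 'X_a) | inr b => ev2 'X_b end).
have ev'C c : ev' c%:MP = j (i c) by rewrite /ev' /= mmapC.
have ev'l a : ev' 'X_(lshift m a) = j (ev 'X_a).
  by rewrite /ev' /= mmapX mmap1U -[lshift m a]/(unsplit (inl a)) unsplitK.
have ev'r b : ev' 'X_(rshift n b) = ev2 'X_b.
  by rewrite /ev' /= mmapX mmap1U -[rshift n b]/(unsplit (inr b)) unsplitK.
pose h : {rmorphism {mpoly k[n]} -> {fraction {mpoly k[n + m]}}} :=
  @tofrac _ \o mmap (@mpolyC (n + m) k) (fun a => 'X_(lshift m a)).
have hC c : h c%:MP = tofrac c%:MP by rewrite /h /= mmapC.
have h_reg r : regular_at ev' (h r) (j (ev r)).
  elim/mpoly_generated_ind: r => [c|a|p q|p q].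
  - by rewrite hC evC -ev'C; apply: regular_at_tofrac.
  - by rewrite /h /= mmapX mmap1U -ev'l; apply: regular_at_tofrac.
  - by rewrite !rmorphD; apply: regular_atD.
  - by rewrite !rmorphM; apply: regular_atM.
(* [sigma'] is [sigma] followed by the inclusion of k(X) in k(X, Y). *)
have [sigma' [sigma'_reg sigma'E]] := residue_split_lift h_reg sigma_reg.
(* Coefficients in [K] become rational functions of X through [sigma']; their residue at (x, y) is
   their image under [j], which matches [ev2] on constants. *)
pose h2 : {rmorphism {mpoly K[m]} -> {fraction {mpoly k[n + m]}}} :=
  mmap sigma' (fun b => tofrac 'X_(rshift n b)).
have h2C c : h2 c%:MP = sigma' c by rewrite /h2 /= mmapC.
have h2_reg r : regular_at ev' (h2 r) (idfun (ev2 r)).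
  elim/mpoly_generated_ind: r => [c|b|p q|p q].
  - by rewrite h2C /= ev2C.
  - by rewrite /h2 /= mmapX mmap1U -ev'r; apply: regular_at_tofrac.
  - by rewrite !rmorphD; apply: regular_atD.
  - by rewrite !rmorphM; apply: regular_atM.
have [theta [theta_reg thetaE]] := residue_split_lift h2_reg rho_reg.
exists (n + m)%N, ev', theta; split=> // c.
by rewrite /= (thetaE _ _ (rhoC _)) h2C (sigma'E _ _ (sigmaC _)) hC.
Qed.

(** * From sections of residue maps back to retractions *)

Section LocalizationOfProduct.
Variables (R : idomainType) (q w : R).
Hypotheses (q0 : q != 0) (w0 : w != 0).

Let tq0 : tofrac q != 0. Proof. by rewrite tofrac_eq0. Qed.
Let tw0 : tofrac w != 0. Proof. by rewrite tofrac_eq0. Qed.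

Lemma in_localization_mulr x :
  x \in in_localization q -> x \in in_localization (q * w).
Proof.
move=> /in_localizationP[p [m ->]]; apply/in_localizationP.
exists (p * w ^+ m), m.
by rewrite !tofracM exprMn tofracXn -mulf_div divff ?mulr1 ?expf_neq0.
Qed.

Lemma in_localization_div a : tofrac a / tofrac q \in in_localization (q * w).
Proof.
apply: in_localization_mulr; apply/in_localizationP.
by exists a, 1%N; rewrite expr1.
Qed.

Lemma in_localization_invr N m :
  ((tofrac w / tofrac q ^+ N) ^+ m)^-1 \in in_localization (q * w).
Proof.
(* q^N / w = q^(N+1) / (q w). *)
rewrite -exprVn invf_div; apply: rpredX.
apply/in_localizationP; exists (q ^+ N.+1), 1%N.
by rewrite expr1 tofracM tofracXn exprS -mulf_div divff // mul1r.
Qed.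

End LocalizationOfProduct.

Section SubringFractions.
Variables (R : comNzRingType) (E : fieldType) (ev : {rmorphism R -> E}).
Variables (f : R) (evf0 : ev f != 0).

Let in_image : {pred E} := fun y => `[< exists g m, y = ev g / ev f ^+ m >].

Let in_imageP y :
  reflect (exists g m, y = ev g / ev f ^+ m) (y \in in_image).
Proof. exact: asboolP. Qed.

Let in_image_subring : subring_closed in_image.
Proof.
split=> [|x y|x y].
- by apply/in_imageP; exists 1, 0%N; rewrite rmorph1 expr0 divr1.
- move=> /in_imageP[g [m ->]] /in_imageP[g' [m' ->]]; apply/in_imageP.
  exists (g * f ^+ m' - g' * f ^+ m), (m + m')%N.
  rewrite rmorphB !rmorphM !rmorphXn exprD.
  by field; rewrite !expf_neq0.
- move=> /in_imageP[g [m ->]] /in_imageP[g' [m' ->]]; apply/in_imageP.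
  by exists (g * g'), (m + m')%N; rewrite rmorphM exprD mulf_div.
Qed.

Lemma image_fraction_subring : exists S : subringClosed E, forall y,
  y \in S <-> exists g m, y = ev g / ev f ^+ m.
Proof.
pose S : subringClosed E :=
  HB.pack in_image (GRing.isSubringClosed.Build E in_image in_image_subring).
by exists S => y; split=> /in_imageP.
Qed.

End SubringFractions.

Lemma rmorphism_factor (D T U : nzRingType) (t : {rmorphism T -> U})
    (h : {rmorphism D -> U}) :
    injective t -> (forall y, exists z, t z = h y) ->
  exists h' : {rmorphism D -> T}, forall y, t (h' y) = h y.
Proof.
move=> t_inj /choice[h' h'E].
have h'B : zmod_morphism h'.
  by move=> x y; apply: t_inj; rewrite rmorphB !h'E rmorphB.
have h'M : monoid_morphism h'.
  split=> [|x y]; apply: t_inj; first by rewrite h'E !rmorph1.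
  by rewrite rmorphM !h'E rmorphM.
pose h'm : {rmorphism D -> T} := HB.pack h'
  (GRing.isZmodMorphism.Build D T h' h'B)
  (GRing.isMonoidMorphism.Build D T h' h'M).
by exists h'm.
Qed.

(** Take A = F[x, 1/f(x)] inside [E], where x is the point, with [phi] the restriction of [sigma]
    and [psi] evaluation at x. The work is to find f, nonzero at x, such that [sigma] maps A into
    F[X][1/f]. *)
Lemma residue_split_retract_rational (F E : fieldType)
    (i : {rmorphism F -> E}) :
  residue_split i -> retract_rational i.
Proof.
move=> [n [ev [sigma [evC sigmaC sigma_reg]]]].
have [a aP] := choice (fun s => sigma_reg (ev 'X_s)).
have {aP} [b abP] := choice aP.
(* A common denominator of the [sigma] images of the coordinates, so that [sigma] maps F[x] into
   F[X][1/q]. *)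
pose q := \prod_s b s.
have evq0 : ev q != 0.
  by rewrite rmorph_prod; apply/prodf_neq0 => s _; have [] := abP s.
have ev_neq0 p : ev p != 0 -> p != 0.
  by apply: contra_neq => ->; rewrite rmorph0.
have sigma_q g : sigma (ev g) \in in_localization q.
  elim/mpoly_generated_ind: g => [c|s|g1 g2|g1 g2].
  - by rewrite evC sigmaC tofrac_in_localization.
  - have [_ -> _] := abP s; rewrite /q (bigD1 s) //=.
    have := ev_neq0 _ evq0; rewrite /q (bigD1 s) //= mulf_eq0 negb_or.
    by move=> /andP[bs0 c0]; apply: in_localization_div.
  - by rewrite !rmorphD; apply: rpredD.
  - by rewrite !rmorphM; apply: rpredM.
(* Inverting q(x) in A requires inverting its image w / q^N, hence w. Taking residues gives w(x) =
   q(x)^(N+1), so w does not vanish at x either. *)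
have /in_localizationP[w [N sigma_qE]] := sigma_q q.
have evqN m : ev (q ^+ m) != 0 by rewrite rmorphXn expf_neq0.
have evw : ev w = ev q ^+ N.+1.
  have /= := regular_atE (sigma_reg (ev q)) (evqN N) _.
  rewrite tofracXn => /(_ _ sigma_qE) E1.
  by rewrite exprS {1}E1 rmorphXn divfK // -rmorphXn.
(* With this f, sigma (ev f) = sigma (ev q) ^ (N + 2) = (w / q ^ N) ^ (N + 2)
   is a unit of F[X][1/f], so sigma maps F[ev X, 1 / ev f] into F[X][1/f]. *)
pose f := q * w.
have evf : ev f = ev q ^+ N.+2 by rewrite rmorphM evw -exprS.
have evf0 : ev f != 0 by rewrite evf expf_neq0.
have evfX m : ev (f ^+ m) != 0 by rewrite rmorphXn expf_neq0.
have q0 := ev_neq0 _ evq0.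
have w0 : w != 0 by apply: ev_neq0; rewrite evw expf_neq0.
have f0 : f != 0 := ev_neq0 _ evf0.
have sigma_f g : sigma (ev g) \in in_localization f.
  exact: in_localization_mulr.
have sigma_fV : sigma (ev f)^-1 \in in_localization f.
  by rewrite fmorphV evf rmorphXn sigma_qE; apply: in_localization_invr.
have [S SP] := image_fraction_subring evf0.
have sigmaS y : y \in S -> sigma y \in in_localization f.
  move=> /SP[g [m ->]]; rewrite -exprVn rmorphM rmorphXn.
  by apply: rpredM => //; apply: rpredX.
have fVS : (ev f)^-1 \in S.
  by apply/SP; exists 1, 1%N; rewrite rmorph1 div1r expr1.
pose A : idomainType := subring_of S.
have evS g : ev g \in S.
  by apply/SP; exists g, 0%N; rewrite expr0 divr1.
have [a' a'E] : exists a' : {rmorphism F -> A}, forall c, val (a' c) = ev c%:MP.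
  pose ev0 : {rmorphism F -> E} := ev \o @mpolyC n F.
  apply: (rmorphism_factor (h := ev0) val_inj) => c.
  by exists (SubringOf (evS c%:MP)).
pose e : {rmorphism A -> E} := val.
have [phi phiE] : exists phi : {rmorphism A -> localization f},
    forall y, val (phi y) = sigma (val y).
  pose h : {rmorphism A -> {fraction {mpoly F[n]}}} := sigma \o e.
  apply: (rmorphism_factor (h := h) val_inj) => y.
  by exists (Localization (sigmaS _ (valP y))).
(* Evaluation at x, defined on all of F[X][1/f] because f(x) is nonzero. *)
have [||z|psi psiE] := @fraction_rmorphism _ (localization f) A _ _
    (val : {rmorphism _ -> _}) e (@tofrac {mpoly F[n]}) ev.
- exact: val_inj.
- by move=> r /eqP; rewrite tofrac_eq0 => /eqP->; rewrite rmorph0.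
- have /in_localizationP[p [m zE]] := valP z.
  have pS : ev p / ev (f ^+ m) \in S.
    by apply/SP; exists p, m; rewrite rmorphXn.
  by exists p, (f ^+ m), (SubringOf pS); rewrite /= tofracXn.
exists A, a', e, n, f, phi, psi; split=> //.
(* Generators: the n coordinates of x, then 1/f(x) as value of the extra variable, whose m-th power
   times g represents g(x) / f(x)^m. *)
- pose fV : A := SubringOf fVS.
  pose x s : A := SubringOf (evS 'X_s).
  pose y (s : 'I_(n + 1)) := match split s with inl s => x s | inr _ => fV end.
  exists (n + 1)%N, y => z; have /SP[g [m zE]] := valP z.
  pose W : {rmorphism {mpoly F[n]} -> {mpoly F[n + 1]}} :=
    mmap (@mpolyC (n + 1) F) (fun s => 'X_(lshift 1 s)).
  pose evy : {rmorphism {mpoly F[n + 1]} -> A} := mmap a' y.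
  have evyW p : val (evy (W p)) = ev p.
    elim/mpoly_generated_ind: p => [c|s|p1 p2|p1 p2].
    - by rewrite /W /= mmapC /= mmapC a'E.
    - rewrite /W /= mmapX mmap1U /= mmapX mmap1U /y.
      by rewrite -[lshift 1 s]/(unsplit (inl s)) unsplitK.
    - by move=> E1 E2; rewrite !rmorphD /= E1 E2.
    - by move=> E1 E2; rewrite !rmorphM /= E1 E2.
  exists (W g * 'X_(rshift n ord0) ^+ m); apply: val_inj.
  rewrite -[mmap _ _ _]/(evy _) rmorphM rmorphXn !rmorphM !rmorphXn /=.
  rewrite evyW mmapX mmap1U /y.
  by rewrite -[rshift n ord0]/(unsplit (inr ord0)) unsplitK zE exprVn.
- split; last by move=> c; rewrite /= a'E evC.
  split; first exact: val_inj.
  move=> l; have [p [r [r0 _ ->]]] := sigma_reg l.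
  by exists (SubringOf (evS p)), (SubringOf (evS r)).
- split=> c; apply: val_inj.
    by rewrite [LHS]phiE a'E evC sigmaC.
  by rewrite [LHS](psiE _ c%:MP 1) ?a'E ?rmorph1 ?divr1 ?oner_neq0.
(* The retraction identity is the section property: [sigma] sends y to some p / r whose value at x
   is y. *)
move=> y; apply: val_inj; have [p [r [r0 yE ->]]] := sigma_reg (val y).
by rewrite [LHS](psiE _ p r) //= phiE.
Qed.

Theorem theorem4p2 (k K L : fieldType)
    (i : {rmorphism k -> K}) (j : {rmorphism K -> L})
    (k_infinite : infinite_set [set: k])
    (K_fg : fg_field_ext i)
    (L_fg : fg_field_ext (j \o i))
    (K_rational : retract_rational i)
    (L_rational : retract_rational j) :
  retract_rational (j \o i).
Proof.
apply: residue_split_retract_rational.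
by apply: residue_split_trans; apply: retract_rational_residue_split.
Qed.
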